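(* Let $r\ge 1$ be an integer and $0\le\epsilon<1$. Consider any perturbation $\hat V$ with strength $\epsilon$ and range $r$. Let $E_0^\uparrow\le E_1^\uparrow\le E_2^\uparrow$ be the three lowest eigenvalues, counted with multiplicity, of $\hat H_0+\hat V$. Then for all sufficiently large $N$, $$E_1^\uparrow-E_0^\uparrow\le\Big(\frac{2\epsilon}{1+\epsilon}\Big)^{\frac{N}{2r}}\qquad\text{and}\qquad E_2^\uparrow-E_1^\uparrow\ge 1-\epsilon-\Big(\frac{2\epsilon}{1+\epsilon}\Big)^{\frac{N}{2r}}.$$
   Context: Fix an integer $N\ge 2$. Let $c_1,\dots,c_{2N}$ be Majorana operators on the $2^N$-dimensional fermionic Fock space of $N$ modes. These are self-adjoint operators with $c_pc_q+c_qc_p=2\delta_{p,q}I$. Concretely, via the Jordan–Wigner map on $N$ qubits, $c_{2j-1}=Z_1\cdots Z_{j-1}X_j$ and $c_{2j}=Z_1\cdots Z_{j-1}Y_j$. The unperturbed Hamiltonian is $\hat H_0=\frac{i}{2}\sum_{j=1}^{N-1}c_{2j}c_{2j+1}$. A perturbation is an operator $\hat V=\frac{i}{4}\sum_{p,q=1}^{2N}V_{p,q}c_pc_q$, where $V$ is a real antisymmetric $2N\times 2N$ matrix. The perturbation has strength $\epsilon$ if $\|V\|\le\epsilon$ (operator norm of the matrix $V$). It has range $r$ if $V_{p,q}=0$ whenever $|p-q|>r$. *)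

(* Defs.v *)
From HB Require Import structures.
From mathcomp Require Import all_boot all_order all_algebra.
Set Implicit Arguments. Unset Strict Implicit. Unset Printing Implicit Defensive.
Import Order.TTheory GRing.Theory Num.Theory.
Local Open Scope ring_scope.

Definition real_complete (C : numClosedFieldType) : Prop :=
  forall P : C -> Prop,
    (forall x, P x -> x \is Num.real) ->
    (exists x, P x) ->
    (exists b, b \is Num.real /\ forall x, P x -> x <= b) ->
    exists s, s \is Num.real /\ (forall x, P x -> x <= s) /\
              (forall b, (forall x, P x -> x <= b) -> s <= b).

(* bit l of the natural number n; qubit number l+1 (1-indexed) of the
   computational basis state |n> of N qubits is  bitn l n. *)
Definition bitn (l n : nat) : bool := odd (n %/ 2 ^ l).

(* Majorana operator c_{p+1} (p is 0-based, p < 2N) via Jordan--Wigner: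
   c_{2k+1} = Z_1..Z_k X_{k+1},  c_{2k+2} = Z_1..Z_k Y_{k+1}  (k 0-based site).
   Entry (a,b) is <a| c |b>;  X|b> = |b xor e_k>,  Y|b> = i(-1)^{b_k}|b xor e_k>,
   Z_l|b> = (-1)^{b_l}|b>. *)
Definition majorana (C : numClosedFieldType) (N p : nat) : 'M[C]_(2 ^ N) :=
  \matrix_(a < 2 ^ N, b < 2 ^ N)
    (let k := p./2 in
     if [forall l : 'I_N, (bitn l a == bitn l b) == (val l != k)] then
       (-1) ^+ (\sum_(l < N | (l < k)%N) bitn l b)%N *
       (if odd p then 'i * (-1) ^+ bitn k b else 1)
     else 0).

(* H_0 = (i/2) sum_{j=1}^{N-1} c_{2j} c_{2j+1}  (0-based: c at 2j'+1, 2j'+2). *)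
Definition H0 (C : numClosedFieldType) (N : nat) : 'M[C]_(2 ^ N) :=
  ('i / 2) *: \sum_(j < N.-1) (majorana C N (2 * j + 1) *m majorana C N (2 * j + 2)).

Definition hatV (C : numClosedFieldType) (N : nat) (V : 'M[C]_(2 * N)) : 'M[C]_(2 ^ N) :=
  ('i / 4) *: \sum_(p < 2 * N) \sum_(q < 2 * N) (V p q *: (majorana C N p *m majorana C N q)).

Definition Ham (C : numClosedFieldType) (N : nat) (V : 'M[C]_(2 * N)) : 'M[C]_(2 ^ N) :=
  H0 C N + hatV V.

Definition real_antisym (C : numClosedFieldType) (n : nat) (V : 'M[C]_n) : Prop :=
  (forall p q, V p q \is Num.real) /\ V^T = - V.

Definition vnorm (C : numClosedFieldType) (n : nat) (x : 'cV[C]_n) : C :=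
  sqrtC (\sum_(i < n) `|x i 0| ^+ 2).

Definition opnorm_le (C : numClosedFieldType) (n : nat) (V : 'M[C]_n) (eps : C) : Prop :=
  forall x : 'cV[C]_n, vnorm (V *m x) <= eps * vnorm x.

Definition has_range (C : numClosedFieldType) (n : nat) (V : 'M[C]_n) (r : nat) : Prop :=
  forall p q : 'I_n, (p + r < q)%N || (q + r < p)%N -> V p q = 0.

Definition sorted_eigenvalues (C : numClosedFieldType) (n : nat) (A : 'M[C]_n)
    (E : nat -> C) : Prop :=
  char_poly A = \prod_(i < n) ('X - (E i)%:P) /\
  (forall i j : nat, (i <= j)%N -> (j < n)%N -> E i <= E j).

(* Main.v *)
Require Import Defs.
From HB Require Import structures.
From mathcomp Require Import all_boot all_order all_algebra.
From mathcomp Require Import perm spectral zify ring.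
Set Implicit Arguments. Unset Strict Implicit. Unset Printing Implicit Defensive.
Import Order.TTheory GRing.Theory Num.Theory.
Local Open Scope ring_scope.
Local Open Scope sesquilinear_scope.

(** [Ham V] is the quadratic Hamiltonian [hatV A] of the real antisymmetric matrix
    [A = A0 + V], where [A0] (called [chain] below) has kernel spanned by the two
    ends of the chain and squares to [-1] on their orthogonal complement.  For
    [c(v) = sum_p v_p c_p] one has [[hatV A, c(v)] = c(i A v)].

    First gap: the truncated Neumann series [v = sum_(k <= m) (A0 V)^k e_0] is
    real and satisfies [A v = V (A0 V)^m e_0] as long as the range of [V] does
    not connect the two ends of the chain, so [|A v| <= eps^(m+1) |v|].  If the
    first gap exceeded that rate, the ground state [g] would be nondegenerate,
    hence of definite fermion parity, and [c(v) g], which has the opposite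
    parity, would be an approximate eigenvector for the energy of [g] orthogonal
    to [g].

    Second gap: [i A0] has eigenvalue [-1] with multiplicity [N - 1], so [i A] has
    [N - 1] orthonormal eigenvectors [u_j] with eigenvalues at most [eps - 1].
    Each [c(u_j)] lowers the energy by at least [1 - eps], hence annihilates every
    eigenstate below [E_0 + 1 - eps], and the joint kernel of these [N - 1]
    operators has dimension at most [2]. *)

(** * Norms, adjoints and real antisymmetric matrices *)

Lemma inj_row_full (F : fieldType) m n (A : 'M[F]_(m, n)) :
  (forall y : 'cV_n, A *m y = 0 -> y = 0) -> row_full A.
Proof.
move=> A_inj; rewrite -cokermx_eq0; apply/eqP/matrixP => i j.
have /colP/(_ i) : col j (cokermx A) = 0.
  by apply: A_inj; rewrite colE mulmxA mulmx_coker mul0mx.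
by rewrite !mxE.
Qed.

Lemma char_poly_conj (R : comUnitRingType) n (P A : 'M[R]_n) :
  P \in unitmx -> char_poly (P *m A *m invmx P) = char_poly A.
Proof.
move=> P_unit; rewrite /char_poly /char_poly_mx; set f := map_mx polyC.
have fPV : f P *m f (invmx P) = 1%:M by rewrite -map_mxM mulmxV ?map_mx1.
have -> : 'X%:M - f (P *m A *m invmx P) = f P *m ('X%:M - f A) *m f (invmx P).
  rewrite mulmxBr mulmxBl [f (_ *m _)]map_mxM [map_mx _ (P *m A)]map_mxM.
  by rewrite mul_mx_scalar -scalemxAl fPV scalemx1.
by rewrite !det_mulmx mulrAC -det_mulmx fPV det1 mul1r.
Qed.

Lemma diagonalized_col (R : comNzRingType) n k (M : 'M[R]_n) (U : 'M[R]_(n, k))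
    (d : 'rV[R]_k) i :
  M *m U = U *m diag_mx d -> M *m col i U = d 0 i *: col i U.
Proof.
move=> MU; rewrite [LHS]mulmx_colsub MU mul_mx_diag; apply/colP => j.
by rewrite !mxE mulrC.
Qed.

Section Adjoint.
Variable C : numClosedFieldType.

Lemma trmxCE m n (A : 'M[C]_(m, n)) i j : (A ^t* ) i j = (A j i)^*.
Proof. by rewrite !mxE. Qed.

Lemma trmxC_mul m n p (A : 'M[C]_(m, n)) (B : 'M[C]_(n, p)) :
  (A *m B) ^t* = B ^t* *m A ^t*.
Proof. by rewrite trmx_mul map_mxM. Qed.

Lemma trmxCZ m n a (A : 'M[C]_(m, n)) : (a *: A) ^t* = a^* *: A ^t*.
Proof. by rewrite linearZ map_mxZ. Qed.

Lemma trmxC_sum m n (I : finType) (A : I -> 'M[C]_(m, n)) :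
  (\sum_i A i) ^t* = \sum_i (A i) ^t*.
Proof. by rewrite linear_sum map_mx_sum. Qed.

Lemma normalmx_selfadj n (A : 'M[C]_n) : A ^t* = A -> A \is normalmx.
Proof. by move=> A_herm; apply/normalmxP; rewrite A_herm. Qed.

Lemma unitarymx_trmxC_mul n (U : 'M[C]_n) :
  U \is unitarymx -> U ^t* *m U = 1%:M.
Proof. by move=> /unitarymxP/mulmx1C. Qed.

Lemma colsub_unitarymx n k (U : 'M[C]_n) (f : 'I_k -> 'I_n) :
  U \is unitarymx -> injective f ->
  (colsub f U) ^t* *m colsub f U = 1%:M.
Proof.
move=> /unitarymx_trmxC_mul/matrixP UU f_inj; apply/matrixP => i j.
rewrite [RHS]mxE -(inj_eq f_inj); have := UU (f i) (f j); rewrite !mxE => <-.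
by apply: eq_bigr => p _; rewrite !mxE.
Qed.

Lemma trmxC_mul_coord m n (U : 'M[C]_(m, n)) (x : 'cV[C]_m) i :
  (U ^t* *m x) i 0 = ((col i U) ^t* *m x) 0 0.
Proof. by rewrite !mxE; apply: eq_bigr => p _; rewrite !mxE. Qed.

Lemma col_unitarymx_neq0 n (U : 'M[C]_n) i : U \is unitarymx -> col i U != 0.
Proof.
move=> /unitarymx_trmxC_mul UU; apply/eqP => Ui0.
have /colP/(_ i)/eqP : U ^t* *m col i U = 0 by rewrite Ui0 mulmx0.
by rewrite [_ *m col _ _]mulmx_colsub UU !mxE eqxx oner_eq0.
Qed.

End Adjoint.

Section Norm.
Variable C : numClosedFieldType.

Lemma sqr_vnormE n (x : 'cV[C]_n) : vnorm x ^+ 2 = \sum_i `|x i 0| ^+ 2.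
Proof. exact: sqrtCK. Qed.

Lemma sqr_vnorm n (x : 'cV[C]_n) : vnorm x ^+ 2 = (x ^t* *m x) 0 0.
Proof.
by rewrite sqr_vnormE mxE; apply: eq_bigr => i _; rewrite trmxCE normCKC.
Qed.

Lemma vnorm_ge0 n (x : 'cV[C]_n) : 0 <= vnorm x.
Proof. by rewrite sqrtC_ge0 sumr_ge0 // => i _; rewrite exprn_ge0. Qed.

Lemma vnorm_le_sqr m n (x : 'cV[C]_m) (y : 'cV[C]_n) a : 0 <= a ->
  (vnorm x <= a * vnorm y) = (vnorm x ^+ 2 <= a ^+ 2 * vnorm y ^+ 2).
Proof. by move=> a_ge0; rewrite -exprMn ler_sqr ?nnegrE ?mulr_ge0 ?vnorm_ge0. Qed.

Lemma vnorm_eq0 n (x : 'cV[C]_n) : (vnorm x == 0) = (x == 0).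
Proof.
rewrite -sqrf_eq0 sqr_vnormE psumr_eq0 => [|i _]; last exact: exprn_ge0.
apply/allP/eqP => [x0|-> i _]; last by rewrite mxE normr0 expr0n /=.
apply/colP => i; have := x0 i (mem_index_enum i).
by rewrite /= sqrf_eq0 normr_eq0 mxE => /eqP.
Qed.

Lemma vnorm0 n : vnorm (0 : 'cV[C]_n) = 0.
Proof. by apply/eqP; rewrite vnorm_eq0. Qed.

Lemma normr_le_vnorm n (x : 'cV[C]_n) i : `|x i 0| <= vnorm x.
Proof.
rewrite -ler_sqr ?nnegrE ?vnorm_ge0 // sqr_vnormE (bigD1 i) //= lerDl.
by rewrite sumr_ge0 // => j _; rewrite exprn_ge0.
Qed.

Lemma vnormZ n a (x : 'cV[C]_n) : vnorm (a *: x) = `|a| * vnorm x.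
Proof.
apply/eqP; rewrite -(@eqrXn2 _ 2) ?mulr_ge0 ?vnorm_ge0 //; apply/eqP.
rewrite exprMn !sqr_vnormE mulr_sumr; apply: eq_bigr => i _.
by rewrite mxE normrM exprMn.
Qed.

Lemma vnorm_scaled_isometry m n (B : 'M[C]_(m, n)) a (x : 'cV[C]_n) :
  0 <= a -> B ^t* *m B = (a ^+ 2)%:M -> vnorm (B *m x) = a * vnorm x.
Proof.
move=> a_ge0 BB; apply/eqP; rewrite -(@eqrXn2 _ 2) ?mulr_ge0 ?vnorm_ge0 //.
apply/eqP; rewrite exprMn !sqr_vnorm trmxC_mul mulmxA -(mulmxA _ _ B) BB.
by rewrite mul_mx_scalar -scalemxAl mxE.
Qed.

Lemma vnorm_unitary n (U : 'M[C]_n) (x : 'cV[C]_n) :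
  U \is unitarymx -> vnorm (U *m x) = vnorm x.
Proof.
move=> /unitarymx_trmxC_mul UU.
by rewrite (@vnorm_scaled_isometry _ _ _ 1) ?mul1r // expr1n.
Qed.

Lemma opnorm_le_mul n (A B : 'M[C]_n) a b :
  0 <= a -> opnorm_le A a -> opnorm_le B b -> opnorm_le (A *m B) (a * b).
Proof.
move=> a_ge0 A_le B_le x; rewrite -mulmxA; apply: le_trans (A_le _) _.
by rewrite -mulrA ler_wpM2l.
Qed.

End Norm.

Section RealAntisymmetric.
Variables (C : numClosedFieldType) (n : nat).
Implicit Types (A B : 'M[C]_n) (p q : 'I_n).

Lemma real_antisymC A p q : real_antisym A -> A p q = - A q p.
Proof. by move=> [_ /matrixP/(_ q p)]; rewrite !mxE. Qed.

Lemma real_antisym_diag A p : real_antisym A -> A p p = 0.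
Proof.
by move=> /(real_antisymC p p)/eqP; rewrite -addr_eq0 -mulr2n mulrn_eq0 /= => /eqP.
Qed.

Lemma real_antisym_realmx A : real_antisym A -> A \is a realmx.
Proof. by move=> [A_real _]; apply/mxOverP. Qed.

Lemma real_antisymD A B :
  real_antisym A -> real_antisym B -> real_antisym (A + B).
Proof.
move=> [A_real A_tr] [B_real B_tr]; split=> [p q|]; first by rewrite mxE realD.
by rewrite linearD /= A_tr B_tr opprD.
Qed.

Lemma trmxC_real_antisym A : real_antisym A -> A ^t* = - A.
Proof.
move=> A_antisym; have [_ ->] := A_antisym.
by rewrite raddfN /= realmxC // real_antisym_realmx.
Qed.

Lemma normalmx_imaginary_antisym A : real_antisym A -> 'i *: A \is normalmx.
Proof.
move=> A_antisym; apply: normalmx_selfadj.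
by rewrite trmxCZ conjCi trmxC_real_antisym // scalerN scaleNr opprK.
Qed.

End RealAntisymmetric.

Section AlternatingProducts.
Variables (C : numClosedFieldType) (n : nat).
Implicit Types A V : 'M[C]_n.

Lemma has_range_mul A V s r :
  has_range A s -> has_range V r -> has_range (A *m V) (s + r).
Proof.
move=> A_range V_range p q far_pq; rewrite mxE big1 // => t _.
have [far_pt|near_pt] := boolP ((p + s < t)%N || (t + s < p)%N).
  by rewrite A_range ?mul0r.
by rewrite V_range ?mulr0 //; lia.
Qed.

Fixpoint alternating_prod A V m : 'M[C]_n :=
  if m is m'.+1 then V *m A *m alternating_prod A V m' else V.

Lemma alternating_prodSr A V m :
  alternating_prod A V m.+1 = alternating_prod A V m *m A *m V.
Proof.
elim: m => [//|m IH].
by rewrite -[LHS]/(V *m A *m alternating_prod A V m.+1) {1}IH /= !mulmxA.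
Qed.

Lemma alternating_prod_real_antisym A V m :
  real_antisym A -> real_antisym V -> real_antisym (alternating_prod A V m).
Proof.
move=> A_antisym V_antisym; split.
  apply/mxOverP; elim: m => [|m IH] /=; first exact: real_antisym_realmx.
  by rewrite !mxOverM // real_antisym_realmx.
have [[_ A_tr] [_ V_tr]] := (A_antisym, V_antisym).
elim: m => [//|m IH]; rewrite [in LHS]alternating_prodSr !trmx_mul IH A_tr V_tr.
by rewrite !(mulNmx, mulmxN) !opprK mulmxA.
Qed.

Lemma alternating_prod_range A V s r m : has_range A s -> has_range V r ->
  has_range (alternating_prod A V m) (m * (r + s) + r).
Proof.
move=> A_range V_range; elim: m => [//|m IH].
by rewrite mulSn -addnA; do 2?apply: has_range_mul.
Qed.

Lemma alternating_prod_opnorm A V a e m : 0 <= a -> 0 <= e ->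
  opnorm_le A a -> opnorm_le V e ->
  opnorm_le (alternating_prod A V m) ((e * a) ^+ m * e).
Proof.
move=> a_ge0 e_ge0 A_le V_le; elim: m => [|m IH] /=; first by rewrite mul1r.
by rewrite exprS -mulrA; do 2?apply: opnorm_le_mul; rewrite ?mulr_ge0.
Qed.

End AlternatingProducts.

(** * Spectral gaps from approximate eigenvectors and ladder operators *)

(* Each [b i] halves the room: if [L] is a left inverse of [W], then
   [L (1 - b' b)] and [L b] assemble into a left inverse of [W, b' W], so the
   joint kernel of the remaining operators is twice as large. *)
Lemma car_joint_kernel_dim (F : fieldType) n m w (b b' : 'I_m -> 'M[F]_n)
    (W : 'M[F]_(n, w)) :
  (forall i j, b i *m b' j + b' j *m b i = (i == j)%:R%:M) ->
  (forall i, b i *m W = 0) -> row_full W -> (2 ^ m * w <= n)%N.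
Proof.
elim: m w b b' W => [|m IH] w b b' W car bW0 W_full.
  by rewrite mul1n -(eqP W_full) rank_leq_row.
have b'W i j : b i *m (b' j *m W) = (i == j)%:R *: W.
  have /(congr1 (mulmx^~ W)) := car i j.
  by rewrite mulmxDl -!mulmxA bW0 mulmx0 addr0 mul_scalar_mx.
have -> : (2 ^ m.+1 * w = 2 ^ m * (w + w))%N by rewrite expnS; lia.
apply: (IH _ (b \o lift ord0) (b' \o lift ord0) (row_mx W (b' ord0 *m W))).
- by move=> i j; rewrite /= car (inj_eq lift_inj).
- move=> i; rewrite mul_mx_row /= bW0 b'W eq_sym (negPf (neq_lift _ _)).
  by rewrite scale0r row_mx0.
have /row_fullP[L LW] := W_full; apply/row_fullP.
exists (col_mx (L *m (1%:M - b' ord0 *m b ord0)) (L *m b ord0)).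
rewrite mul_col_row -!mulmxA !mulmxBl !mul1mx -!mulmxA bW0 b'W eqxx scale1r.
by rewrite !mulmx0 subr0 subrr mulmx0 LW -scalar_mx_block.
Qed.

Section ApproximateEigenvectors.
Variables (C : numClosedFieldType) (n : nat).
Implicit Types (M U : 'M[C]_n) (d : 'rV[C]_n) (x y : 'cV[C]_n) (mu e : C).

Lemma diag_mx_norm_le_eq0 d y e : 0 <= e ->
  vnorm (diag_mx d *m y) <= e * vnorm y ->
  (forall j, `|d 0 j| <= e -> y j 0 = 0) -> y = 0.
Proof.
move=> e_ge0; rewrite vnorm_le_sqr // !sqr_vnormE -subr_le0 mulr_sumr -sumrB.
under eq_bigr => j _ do rewrite mul_diag_mx mxE normrM exprMn -mulrBl.
move=> sum_le0 y_small.
have d_large j : y j 0 != 0 -> 0 < `|d 0 j| ^+ 2 - e ^+ 2.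
  apply: contraNT; rewrite subr_gt0 ltr_sqr ?nnegrE // -real_leNgt ?ger0_real //.
  by move/y_small->.
have term_ge0 j : 0 <= (`|d 0 j| ^+ 2 - e ^+ 2) * `|y j 0| ^+ 2.
  have [->|/d_large/ltW diff_ge0] := eqVneq (y j 0) 0.
    by rewrite normr0 expr0n mulr0.
  by rewrite mulr_ge0 ?exprn_ge0.
have sum0 : \sum_j (`|d 0 j| ^+ 2 - e ^+ 2) * `|y j 0| ^+ 2 = 0.
  by apply/eqP; rewrite eq_le sum_le0 sumr_ge0.
apply/colP => j; rewrite [RHS]mxE; have [//|yj_neq0] := eqVneq (y j 0) 0.
have /eqP : (`|d 0 j| ^+ 2 - e ^+ 2) * `|y j 0| ^+ 2 = 0.
  by apply: (psumr_eq0P _ sum0) => // i _; apply: term_ge0.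
rewrite mulf_eq0 (gt_eqF (d_large j yj_neq0)) sqrf_eq0 normr_eq0.
by rewrite (negPf yj_neq0).
Qed.

Lemma approx_eigenvector_eq0 M U d mu e x :
  U \is unitarymx -> M *m U = U *m diag_mx d -> 0 <= e ->
  vnorm (M *m x - mu *: x) <= e * vnorm x ->
  (forall j, `|d 0 j - mu| <= e -> (U ^t* *m x) j 0 = 0) -> x = 0.
Proof.
move=> U_unitary MU e_ge0; have /unitarymxP UU := U_unitary.
have [y ->] : exists y, x = U *m y.
  by exists (U ^t* *m x); rewrite mulmxA UU mul1mx.
have -> : M *m (U *m y) - mu *: (U *m y) = U *m (diag_mx (d - const_mx mu) *m y).
  rewrite linearB /= diag_const_mx mulmxBl mulmxBr mul_scalar_mx scalemxAr.
  by rewrite !mulmxA MU.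
rewrite !(vnorm_unitary _ U_unitary) mulmxA unitarymx_trmxC_mul // mul1mx.
move=> resid y_small; suff -> : y = 0 by rewrite mulmx0.
apply: diag_mx_norm_le_eq0 e_ge0 resid _ => j.
by rewrite !mxE => /y_small.
Qed.

Lemma eigenvector_diag M U d a x :
  U \is unitarymx -> M *m U = U *m diag_mx d ->
  x != 0 -> M *m x = a *: x -> exists j, a = d 0 j.
Proof.
move=> U_unitary MU x_neq0 Mx; apply/'exists_eqP; apply: contraNT x_neq0.
rewrite negb_exists => /forallP a_notin; apply/eqP.
apply: (approx_eigenvector_eq0 (mu := a) U_unitary MU (lexx 0)) => [|j].
  by rewrite Mx subrr mul0r vnorm0.
by rewrite normr_le0 subr_eq0 eq_sym (negPf (a_notin j)).
Qed.

Lemma simple_eigenvector M U d i x :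
  U \is unitarymx -> M *m U = U *m diag_mx d ->
  (forall j, d 0 j = d 0 i -> j = i) -> M *m x = d 0 i *: x ->
  exists a, x = a *: col i U.
Proof.
move=> U_unitary MU d_simple Mx; exists ((U ^t* *m x) i 0); apply/eqP.
rewrite -subr_eq0; apply/eqP.
apply: (approx_eigenvector_eq0 (mu := d 0 i) U_unitary MU (lexx 0)) => [|j].
  rewrite mulmxBr Mx -scalemxAr (diagonalized_col i MU) scalerBr !scalerA.
  by rewrite mulrC subrr mul0r vnorm0.
rewrite normr_le0 subr_eq0 => /eqP/d_simple->.
rewrite mulmxBr -scalemxAr colE mulmxA unitarymx_trmxC_mul // mul1mx.
by rewrite !mxE !eqxx mulr1 subrr.
Qed.

End ApproximateEigenvectors.

Section Eigenbases.
Variables (C : numClosedFieldType) (n : nat).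
Implicit Types (M A U : 'M[C]_n) (E : nat -> C).

Lemma normal_eigenbasis M : M \is normalmx ->
  exists (U : 'M[C]_n) (d : 'rV[C]_n),
    U \is unitarymx /\ M *m U = U *m diag_mx d.
Proof.
move=> /orthomx_spectralP M_diag; set P := spectralmx M in M_diag.
have P_unitary : P \is unitarymx := spectral_unitarymx M.
exists (P ^t* ), (spectral_diag M); split; first by rewrite trmxC_unitary.
rewrite {1}M_diag invmx_unitary // -!mulmxA; congr (_ *m _).
by have /unitarymxP-> := P_unitary; rewrite mulmx1.
Qed.

(* The eigenvectors of [M] whose eigenvalue is within [e] of [mu] are at least
   [k] in number: otherwise some nonzero [X *m y] would be orthogonal to all of
   them, against [approx_eigenvector_eq0]. *)
Lemma orthonormal_eigenvectors_near k M (X : 'M[C]_(n, k)) (mu e : C) :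
  M \is normalmx -> row_full X -> 0 <= e ->
  (forall y : 'cV_k,
     vnorm (M *m (X *m y) - mu *: (X *m y)) <= e * vnorm (X *m y)) ->
  exists (Y : 'M[C]_(n, k)) (lam : 'rV[C]_k),
    [/\ Y ^t* *m Y = 1%:M, M *m Y = Y *m diag_mx lam
      & forall i, `|lam 0 i - mu| <= e].
Proof.
move=> /normal_eigenbasis[U [d [U_unitary MU]]] X_full e_ge0 X_near.
pose S := [set j : 'I_n | `|d 0 j - mu| <= e].
have le_k_S : (k <= #|S|)%N.
  have : row_full (rowsub (@enum_val _ (mem S)) (U ^t* *m X)).
    apply: inj_row_full => y Sy0; apply: (row_full_inj X_full); rewrite mulmx0.
    apply: approx_eigenvector_eq0 U_unitary MU e_ge0 (X_near y) _ => j near_j.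
    have j_in_S : j \in S by rewrite inE.
    have /colP/(_ (enum_rank_in j_in_S j)) := Sy0.
    by rewrite mul_rowsub_mx [LHS]mxE [RHS]mxE enum_rankK_in // mulmxA.
  by move=> /eqP <-; apply: rank_leq_row.
pose f (i : 'I_k) : 'I_n := enum_val (widen_ord le_k_S i).
have f_inj : injective f by move=> i j /enum_val_inj[] /val_inj.
exists (colsub f U), (colsub f d); split.
- exact: colsub_unitarymx.
- by rewrite mulmx_colsub MU !mul_mx_diag; apply/matrixP => p i; rewrite !mxE.
- by move=> i; rewrite mxE; have := enum_valP (widen_ord le_k_S i); rewrite inE.
Qed.

Lemma sorted_eigenbasis A E : A \is normalmx -> sorted_eigenvalues A E ->
  exists2 U : 'M[C]_n, U \is unitarymx & A *m U = U *m diag_mx (\row_i E i).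
Proof.
move=> /normal_eigenbasis[U [d [U_unitary AU]]] [cpE _].
have U_unit := unitarymx_unit U_unitary.
have A_conj : A = U *m diag_mx d *m invmx U by rewrite -AU mulmxK.
have : \prod_(x <- [tuple E i | i < n]) ('X - x%:P)
    = \prod_(x <- [tuple d 0 i | i < n]) ('X - x%:P).
  rewrite !big_tuple; under eq_bigr => i _ do rewrite tnth_mktuple.
  rewrite -cpE A_conj char_poly_conj // char_poly_trig ?diag_mx_is_trig //.
  by apply: eq_bigr => i _; rewrite tnth_mktuple !mxE eqxx mulr1n.
move=> /prod_XsubC_eq/tuple_permP[s E_perm].
have Es (i : 'I_n) : E i = d 0 (s i).
  have /(congr1 (fun t : n.-tuple C => tnth t i)) := val_inj E_perm.
  by rewrite !tnth_mktuple.
exists (col_perm s U).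
  apply/unitarymxP; rewrite tr_col_perm map_row_perm mul_col_perm -row_permM.
  by rewrite mulVg row_perm1; apply/unitarymxP.
rewrite col_permEsub mulmx_colsub AU !mul_mx_diag; apply/matrixP => p i.
by rewrite !mxE Es.
Qed.

Lemma sorted_eigenvalues_sub_ge0 A E (i j : nat) :
  sorted_eigenvalues A E -> (i <= j)%N -> (j < n)%N -> 0 <= E j - E i.
Proof. by move=> [_ E_mono] le_ij lt_jn; rewrite subr_ge0 E_mono. Qed.

Lemma sorted_eigenvalues_sub_real A E (i j : nat) :
  sorted_eigenvalues A E -> (i < n)%N -> (j < n)%N -> E j - E i \is Num.real.
Proof.
move=> E_sorted lt_in lt_jn; have [le_ij|/ltnW le_ji] := leqP i j.
  by rewrite ger0_real // (sorted_eigenvalues_sub_ge0 E_sorted).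
by rewrite -opprB realN ger0_real // (sorted_eigenvalues_sub_ge0 E_sorted).
Qed.

Lemma ground_level_isolated A E (delta : C) (j : 'I_n) :
  sorted_eigenvalues A E -> delta < E 1%N - E 0%N ->
  `|E j - E 0%N| <= delta -> j = 0%N :> nat.
Proof.
move=> E_sorted lt_delta_gap; case: (posnP j) => // j_gt0.
rewrite ger0_norm ?(sorted_eigenvalues_sub_ge0 E_sorted) // => near_j.
have : E 1%N - E 0%N <= delta.
  by apply: le_trans near_j; rewrite lerB // (proj2 E_sorted).
by move/(lt_le_trans lt_delta_gap); rewrite ltxx.
Qed.

End Eigenbases.

Section SpectralGaps.
Variables (C : numClosedFieldType) (n : nat).
Implicit Types (H P B : 'M[C]_n) (E : nat -> C).

Lemma odd_expectation_eq0 P B (g : 'cV[C]_n) a :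
  P ^t* *m P = 1%:M -> P *m B = - (B *m P) -> P *m g = a *: g ->
  g ^t* *m (B *m g) = 0.
Proof.
move=> PP PB Pg.
have flip_sign : g ^t* *m (B *m g) = - (`|a| ^+ 2 *: (g ^t* *m (B *m g))).
  rewrite -[B *m g in LHS]mul1mx -PP -(mulmxA _ P) (mulmxA P) PB mulNmx.
  rewrite -(mulmxA B) Pg mulmxA -trmxC_mul Pg trmxCZ mulmxN -!scalemxAr.
  by rewrite -scalemxAl scalerA normCK.
have /eqP : (1 + `|a| ^+ 2) *: (g ^t* *m (B *m g)) = 0.
  by rewrite scalerDl scale1r {1}flip_sign addNr.
by rewrite scaler_eq0 gt_eqF ?ltr_pwDl ?exprn_ge0 // => /eqP.
Qed.

(* A nondegenerate ground state [g] is an eigenvector of [P], hence [B g] is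
   orthogonal to [g]; its energy is within [delta] of that of [g]. *)
Lemma odd_operator_gap_le H P B E (delta : C) :
  H \is normalmx -> sorted_eigenvalues H E -> (1 < n)%N -> 0 <= delta ->
  P ^t* *m P = 1%:M -> P *m H = H *m P -> P *m B = - (B *m P) ->
  (forall x : 'cV_n, B *m x = 0 -> x = 0) ->
  (forall x : 'cV_n, vnorm ((H *m B - B *m H) *m x) <= delta * vnorm (B *m x)) ->
  E 1%N - E 0%N <= delta.
Proof.
move=> H_normal E_sorted lt_1n delta_ge0 PP PH PB B_inj comm_le.
have [U U_unitary HU] := sorted_eigenbasis H_normal E_sorted.
have gap_real : E 1%N - E 0%N \is Num.real.
  by rewrite (sorted_eigenvalues_sub_real E_sorted) // ltnW.
rewrite real_leNgt ?(ger0_real delta_ge0) //; apply/negP => lt_delta_gap.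
pose ground : 'I_n := Ordinal (ltnW lt_1n).
have ground_isolated (j : 'I_n) : `|E j - E 0%N| <= delta -> j = ground.
  by move=> near_j; apply/val_inj/(ground_level_isolated E_sorted lt_delta_gap).
pose g := col ground U.
have Hg : H *m g = E 0%N *: g by rewrite (diagonalized_col _ HU) mxE.
have [a Pg] : exists a, P *m g = a *: g.
  apply: (simple_eigenvector U_unitary HU) => [j|].
    by rewrite !mxE => Ej; apply: ground_isolated; rewrite Ej subrr normr0.
  by rewrite mxE mulmxA -PH -mulmxA Hg scalemxAr.
have /B_inj/eqP : B *m g = 0.
  apply: (approx_eigenvector_eq0 (mu := E 0%N) U_unitary HU delta_ge0) => [|j].
    by have := comm_le g; rewrite mulmxBl -!mulmxA Hg -scalemxAr.
  rewrite mxE => /ground_isolated->.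
  by rewrite trmxC_mul_coord (odd_expectation_eq0 PP PB Pg) mxE.
by rewrite (negPf (col_unitarymx_neq0 ground U_unitary)).
Qed.

Lemma ladder_operator_level H B U (d : 'rV[C]_n) (lam : C) i :
  U \is unitarymx -> H *m U = U *m diag_mx d ->
  H *m B - B *m H = lam *: B -> B *m col i U != 0 ->
  exists j, lam = d 0 j - d 0 i.
Proof.
move=> U_unitary HU /eqP; rewrite subr_eq => /eqP HB BUi_neq0.
have [|j lam_d] := eigenvector_diag (a := lam + d 0 i) U_unitary HU BUi_neq0.
  rewrite mulmxA HB mulmxDl -scalemxAl -mulmxA (diagonalized_col i HU).
  by rewrite -scalemxAr scalerDl.
by exists j; rewrite -lam_d addrK.
Qed.

(* Below [E 0 + mu - e] every eigenvector is annihilated by all the [b i],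
   whose joint kernel has dimension at most [n / 2 ^ k]. *)
Lemma lowering_operators_gap_ge k w H E (b b' : 'I_k -> 'M[C]_n)
    (lam : 'I_k -> C) (mu e : C) :
  H \is normalmx -> sorted_eigenvalues H E ->
  (forall i j, b i *m b' j + b' j *m b i = (i == j)%:R%:M) ->
  (forall i, H *m b i - b i *m H = lam i *: b i) ->
  mu \is Num.real -> 0 <= e -> (forall i, `|lam i + mu| <= e) ->
  (w < n)%N -> (n < 2 ^ k * w.+1)%N -> mu - e <= E w - E 0%N.
Proof.
move=> H_normal E_sorted car lowering mu_real e_ge0 near_mu lt_wn lt_dim.
have [U U_unitary HU] := sorted_eigenbasis H_normal E_sorted.
have gap_real : E w - E 0%N \is Num.real.
  by rewrite (sorted_eigenvalues_sub_real E_sorted) // (leq_ltn_trans _ lt_wn).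
have bound_real : mu - e \is Num.real by rewrite realB ?(ger0_real e_ge0).
rewrite real_leNgt //; apply/negP => gap_lt.
pose low : 'I_w.+1 -> 'I_n := widen_ord lt_wn.
have low_inj : injective low by move=> i j [] /val_inj.
suff : (2 ^ k * w.+1 <= n)%N by rewrite leqNgt lt_dim.
apply: (car_joint_kernel_dim (W := colsub low U) car) => [i|]; last first.
  by apply/row_fullP; exists ((colsub low U) ^t* ); apply: colsub_unitarymx.
suff killed a : b i *m col (low a) U = 0.
  apply/matrixP => p a; rewrite mulmx_colsub.
  have := killed a; rewrite [_ *m col _ _]mulmx_colsub => /colP/(_ p).
  by rewrite !mxE.
apply/eqP; apply: contraT => bg_neq0.
have [j] := ladder_operator_level U_unitary HU (lowering i) bg_neq0.
rewrite !mxE => lamE.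
have : mu - (E w - E 0%N) <= `|lam i + mu|.
  have E_low : E (low a) <= E w.
    by apply: (proj2 E_sorted) => //; apply: (ltn_ord a).
  have E_min : E 0%N <= E j by rewrite (proj2 E_sorted).
  have lam_real : lam i \is Num.real.
    by rewrite lamE (sorted_eigenvalues_sub_real E_sorted) // (ltn_ord (low a)).
  apply: (@le_trans _ _ (lam i + mu)); last by rewrite real_ler_norm ?realD.
  by rewrite lamE addrC lerD2r opprB lerB.
move=> /le_trans/(_ (near_mu i)); rewrite lerBlDr -lerBlDl.
by move/(lt_le_trans gap_lt); rewrite ltxx.
Qed.

End SpectralGaps.

(** * Majorana operators *)

Lemma bitnS (l a : nat) : bitn l.+1 a = bitn l a./2.
Proof. by rewrite /bitn expnS -divn2 divnMA. Qed.

Lemma bitn_inj (N a b : nat) : (a < 2 ^ N)%N -> (b < 2 ^ N)%N ->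
  (forall l, (l < N)%N -> bitn l a = bitn l b) -> a = b.
Proof.
elim: N a b => [|N IH] a b; first by rewrite expn0; lia.
rewrite expnS => lt_a lt_b eq_bits.
have eq_odd : odd a = odd b.
  by have := eq_bits 0%N isT; rewrite /bitn expn0 !divn1.
rewrite -(odd_double_half a) -(odd_double_half b) eq_odd; congr (_ + _.*2)%N.
apply: IH; [lia|lia|] => l lt_lN.
by rewrite -!bitnS eq_bits.
Qed.

Lemma ord_bitn_inj (N : nat) (a b : 'I_(2 ^ N)) :
  (forall l : 'I_N, bitn l a = bitn l b) -> a = b.
Proof.
move=> eq_bits; apply: val_inj.
apply: (@bitn_inj N) (ltn_ord a) (ltn_ord b) _ => l lt_lN.
exact: (eq_bits (Ordinal lt_lN)).
Qed.

Lemma exists_bitn (N : nat) (f : 'I_N -> bool) :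
  exists a : 'I_(2 ^ N), forall l : 'I_N, bitn l a = f l.
Proof.
pose bits (a : 'I_(2 ^ N)) := [ffun l : 'I_N => bitn l a].
have bits_inj : injective bits.
  move=> a b /ffunP eq_bits; apply: ord_bitn_inj => l.
  by have := eq_bits l; rewrite !ffunE.
have [g _ gK] : bijective bits.
  by apply: inj_card_bij bits_inj _; rewrite card_ffun !card_ord card_bool.
exists (g (finfun f)) => l; have /ffunP/(_ l) := gK (finfun f).
by rewrite !ffunE.
Qed.

Definition flip (N k : nat) (b : 'I_(2 ^ N)) : 'I_(2 ^ N) :=
  odflt b [pick a : 'I_(2 ^ N) |
            [forall l : 'I_N, bitn l a == bitn l b (+) (val l == k)]].

Lemma bitn_flip (N k : nat) (b : 'I_(2 ^ N)) (l : 'I_N) :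
  bitn l (flip k b) = bitn l b (+) (val l == k).
Proof.
rewrite /flip; case: pickP => [a /forallP/(_ l)/eqP //|no_flip].
have [a a_bits] := exists_bitn (fun l : 'I_N => bitn l b (+) (val l == k)).
by have /negP[] := no_flip a; apply/forallP => i; rewrite a_bits.
Qed.

Lemma flipK (N k : nat) : involutive (@flip N k).
Proof. by move=> b; apply: ord_bitn_inj => l; rewrite !bitn_flip addbK. Qed.

Lemma flipC (N j k : nat) (b : 'I_(2 ^ N)) :
  flip j (flip k b) = flip k (flip j b).
Proof. by apply: ord_bitn_inj => l; rewrite !bitn_flip addbAC. Qed.

Section Majorana.
Variables (C : numClosedFieldType) (N : nat).
Implicit Types (a b : 'I_(2 ^ N)) (p q k : nat).

Definition jw_sign k b : C :=
  (-1) ^+ (\sum_(l < N | (l < k)%N) bitn l b)%N.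

Definition jw_phase p b : C :=
  jw_sign p./2 b * (if odd p then 'i * (-1) ^+ bitn p./2 b else 1).

Lemma jw_sign_sqr k b : jw_sign k b ^+ 2 = 1.
Proof. exact: sqrr_sign. Qed.

Lemma jw_sign_conj k b : (jw_sign k b)^* = jw_sign k b.
Proof. exact: rmorph_sign. Qed.

Lemma jw_sign_flip k j b : (j < N)%N ->
  jw_sign k (flip j b) = (-1) ^+ (j < k)%N * jw_sign k b.
Proof.
move=> lt_jN; rewrite /jw_sign !expr_sum.
under eq_bigr => l _ do rewrite bitn_flip signr_addb.
rewrite big_split /= mulrC; congr (_ * _).
rewrite big_mkcond (bigD1 (Ordinal lt_jN)) //= eqxx big1 ?mulr1.
  by case: ifP.
by move=> i /negPf; rewrite -val_eqE /= => ->; case: ifP.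
Qed.

Lemma jw_phase_sqr p b : jw_phase p b ^+ 2 = (-1) ^+ odd p.
Proof.
rewrite exprMn jw_sign_sqr mul1r; case: (odd p); last by rewrite expr1n.
by rewrite exprMn sqrCi sqrr_sign mulr1.
Qed.

Lemma jw_phase_conj p b : (jw_phase p b)^* = (-1) ^+ odd p * jw_phase p b.
Proof.
rewrite /jw_phase rmorphM /= jw_sign_conj.
case: (odd p); last by rewrite rmorph1 expr0 mul1r.
by rewrite rmorphM /= conjCi rmorph_sign expr1; ring.
Qed.

Lemma jw_phase_flip p q b : (p < 2 * N)%N -> (q < 2 * N)%N ->
  jw_phase p (flip q./2 b) =
    (-1) ^+ ((q./2 < p./2)%N || (q./2 == p./2) && odd p) * jw_phase p b.
Proof.
move=> lt_p lt_q; have lt_p2 : (p./2 < N)%N by lia.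
have lt_q2 : (q./2 < N)%N by lia.
rewrite /jw_phase jw_sign_flip // -!mulrA.
have -> : bitn p./2 (flip q./2 b) = bitn p./2 b (+) (p./2 == q./2).
  exact: (bitn_flip q./2 b (Ordinal lt_p2)).
rewrite (eq_sym q./2); case: (odd p); last by rewrite andbF orbF.
rewrite andbT signr_addb; case: ltngtP => _ /=; rewrite ?expr1 ?expr0; ring.
Qed.

Lemma jw_phase_flip_self p b : (p < 2 * N)%N ->
  jw_phase p (flip p./2 b) = (-1) ^+ odd p * jw_phase p b.
Proof. by move=> lt_p; rewrite jw_phase_flip // ltnn eqxx. Qed.

Lemma majoranaE p a b :
  majorana C N p a b = (a == flip p./2 b)%:R * jw_phase p b.
Proof.
rewrite mxE /=; set flipped := [forall l, _].
suff -> : flipped = (a == flip p./2 b) by case: eqP => _; rewrite ?mul1r ?mul0r.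
apply/forallP/eqP => [a_bits|-> l].
  apply: ord_bitn_inj => l; rewrite bitn_flip; have := a_bits l.
  by case: (val l == _); case: (bitn l a); case: (bitn l b).
by rewrite bitn_flip; case: eqP; case: bitn.
Qed.

Lemma majorana_mulE p q a b :
  (majorana C N p *m majorana C N q) a b =
  (a == flip p./2 (flip q./2 b))%:R * (jw_phase p (flip q./2 b) * jw_phase q b).
Proof.
rewrite mxE (bigD1 (flip q./2 b)) //= !majoranaE eqxx mul1r big1 ?addr0 ?mulrA //.
by move=> i /negPf; rewrite !majoranaE => ->; rewrite mul0r mulr0.
Qed.

Lemma majorana_sqr p : (p < 2 * N)%N ->
  majorana C N p *m majorana C N p = 1%:M.
Proof.
move=> lt_p; apply/matrixP => a b.
rewrite majorana_mulE flipK jw_phase_flip_self // -mulrA -expr2 jw_phase_sqr.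
by rewrite -expr2 sqrr_sign mulr1 mxE.
Qed.

Lemma majorana_anticomm p q : (p < 2 * N)%N -> (q < 2 * N)%N ->
  majorana C N p *m majorana C N q + majorana C N q *m majorana C N p
  = (2 * (p == q)%:R)%:M.
Proof.
move=> lt_p lt_q; have [<-|neq_pq] := eqVneq p q.
  by rewrite majorana_sqr // -raddfD mulr1.
apply/matrixP => a b.
rewrite mxE !majorana_mulE !jw_phase_flip // flipC mulr0 raddf0 mxE.
rewrite (eq_sym p./2 q./2).
set q_flips_p := (_ || _ && odd p); set p_flips_q := (_ || _ && odd q).
have -> : p_flips_q = ~~ q_flips_p by rewrite /q_flips_p /p_flips_q; lia.
by rewrite signrN; ring.
Qed.

Lemma majorana_trmxC p : (p < 2 * N)%N ->
  (majorana C N p) ^t* = majorana C N p.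
Proof.
move=> lt_p; apply/matrixP => a b; rewrite trmxCE !majoranaE.
rewrite -(canF_eq (@flipK N p./2)) eq_sym.
case: eqP => [->|_]; last by rewrite !mul0r rmorph0.
rewrite !mul1r jw_phase_conj jw_phase_flip_self //.
by rewrite mulrA -expr2 sqrr_sign mul1r.
Qed.

Definition parity : 'M[C]_(2 ^ N) := diag_mx (\row_b jw_sign N b).

Lemma parity_unitary : parity ^t* *m parity = 1%:M.
Proof.
apply/matrixP => a b; rewrite mul_mx_diag !mxE.
have [_|_] := eqVneq a b; last by rewrite rmorph0 mul0r.
by rewrite !mulr1n jw_sign_conj -expr2 jw_sign_sqr.
Qed.

Lemma parity_majorana p : (p < 2 * N)%N ->
  parity *m majorana C N p = - (majorana C N p *m parity).
Proof.
move=> lt_p; apply/matrixP => a b; rewrite mul_diag_mx [LHS]mxE.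
rewrite [RHS]mxE mul_mx_diag [in RHS]mxE !majoranaE !mxE.
case: eqP => [->|_]; last by rewrite !mul0r mulr0 oppr0.
have lt_p2 : (p./2 < N)%N by lia.
by rewrite jw_sign_flip // lt_p2 expr1; ring.
Qed.

End Majorana.

(** * Quadratic Hamiltonians *)

Section QuadraticHamiltonians.
Variables (C : numClosedFieldType) (N : nat).
Local Notation c := (majorana C N).
Implicit Types (u v : 'cV[C]_(2 * N)) (p q : 'I_(2 * N)) (A : 'M[C]_(2 * N)).

Definition mode v : 'M[C]_(2 ^ N) := \sum_p v p 0 *: c p.

Lemma modeZ a v : mode (a *: v) = a *: mode v.
Proof.
by rewrite /mode scaler_sumr; apply: eq_bigr => p _; rewrite mxE scalerA.
Qed.

Lemma majorana_mode_anticomm p v :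
  c p *m mode v + mode v *m c p = (2 * v p 0)%:M.
Proof.
rewrite /mode mulmx_sumr mulmx_suml -big_split /= (bigD1 p) //= big1 ?addr0.
  rewrite -scalemxAr -scalemxAl -scalerDr majorana_anticomm // eqxx.
  by rewrite scale_scalar_mx mulr1 mulrC.
move=> q /negPf neq_qp; rewrite -scalemxAr -scalemxAl -scalerDr.
rewrite majorana_anticomm // eq_sym (val_eqE q p) neq_qp mulr0.
by rewrite scale_scalar_mx mulr0 raddf0.
Qed.

Lemma mode_anticomm u v :
  mode u *m mode v + mode v *m mode u = (2 * (u^T *m v) 0 0)%:M.
Proof.
rewrite {1 4}/mode mulmx_suml mulmx_sumr -big_split /=.
under eq_bigr => p _.
  rewrite -scalemxAl -scalemxAr -scalerDr majorana_mode_anticomm scale_scalar_mx.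
  over.
rewrite -raddf_sum /= mxE mulr_sumr; congr (_%:M); apply: eq_bigr => p _.
by rewrite mxE; ring.
Qed.

Lemma mode_real_trmxC v : v \is a realmx -> (mode v) ^t* = mode v.
Proof.
move=> /mxOverP v_real; rewrite /mode trmxC_sum; apply: eq_bigr => p _.
by rewrite trmxCZ majorana_trmxC // (CrealP (v_real p 0)).
Qed.

Lemma mode_real_sqr v : v \is a realmx -> mode v *m mode v = (vnorm v ^+ 2)%:M.
Proof.
move=> v_real; have := mode_anticomm v v; rewrite -mulr2n -scaler_nat.
have -> : (v^T *m v) 0 0 = vnorm v ^+ 2 by rewrite sqr_vnorm -map_trmx realmxC.
by rewrite -scale_scalar_mx; apply: scalerI; rewrite pnatr_eq0.
Qed.

Lemma vnorm_mode_mul v (x : 'cV[C]_(2 ^ N)) :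
  v \is a realmx -> vnorm (mode v *m x) = vnorm v * vnorm x.
Proof.
move=> v_real; apply: vnorm_scaled_isometry; first exact: vnorm_ge0.
by rewrite mode_real_trmxC // mode_real_sqr.
Qed.

Lemma parity_mode v : parity C N *m mode v = - (mode v *m parity C N).
Proof.
rewrite /mode mulmx_sumr mulmx_suml -sumrN; apply: eq_bigr => p _.
by rewrite -scalemxAr -scalemxAl parity_majorana // scalerN.
Qed.

Fact hatV_is_linear : linear (@hatV C N).
Proof.
move=> a A B; rewrite /hatV !scaler_sumr -big_split; apply: eq_bigr => p _ /=.
rewrite !scaler_sumr -big_split; apply: eq_bigr => q _ /=.
by rewrite !mxE !scalerA -scalerDl; congr (_ *: _); ring.
Qed.

HB.instance Definition _ :=
  GRing.isLinear.Build C 'M[C]_(2 * N) 'M[C]_(2 ^ N) _ (@hatV C N) hatV_is_linear.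

Lemma hatV_delta p q : hatV (delta_mx p q) = ('i / 4) *: (c p *m c q).
Proof.
rewrite /hatV (bigD1 p) //= [X in _ + X]big1 ?addr0 => [|p' /negPf neq_p'].
  rewrite (bigD1 q) //= [X in _ + X]big1 ?addr0 => [|q' /negPf neq_q'].
    by rewrite mxE !eqxx scale1r.
  by rewrite mxE neq_q' andbF scale0r.
by rewrite big1 // => q' _; rewrite mxE neq_p' scale0r.
Qed.

Lemma parity_hatV A : parity C N *m hatV A = hatV A *m parity C N.
Proof.
rewrite /hatV -scalemxAr -scalemxAl mulmx_sumr mulmx_suml; congr (_ *: _).
apply: eq_bigr => p _; rewrite mulmx_sumr mulmx_suml; apply: eq_bigr => q _.
rewrite -scalemxAr -scalemxAl mulmxA parity_majorana // mulNmx.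
by rewrite -[c p *m _ *m c q]mulmxA parity_majorana // mulmxN opprK mulmxA.
Qed.

Lemma majorana_pair_comm_mode p q v :
  c p *m c q *m mode v - mode v *m (c p *m c q)
  = (2 * v q 0) *: c p - (2 * v p 0) *: c q.
Proof.
have -> : (2 * v q 0) *: c p = c p *m (c q *m mode v + mode v *m c q).
  by rewrite majorana_mode_anticomm mul_mx_scalar.
have -> : (2 * v p 0) *: c q = (c p *m mode v + mode v *m c p) *m c q.
  by rewrite majorana_mode_anticomm mul_scalar_mx.
by rewrite mulmxDl mulmxDr !mulmxA opprD addrA addrK.
Qed.

Lemma hatV_comm_mode A v : real_antisym A ->
  hatV A *m mode v - mode v *m hatV A = mode ('i *: (A *m v)).
Proof.
move=> A_antisym; rewrite /hatV -scalemxAl -scalemxAr -scalerBr.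
suff -> : (\sum_p \sum_q A p q *: (c p *m c q)) *m mode v -
          mode v *m (\sum_p \sum_q A p q *: (c p *m c q)) = 4 *: mode (A *m v).
  by rewrite modeZ scalerA divfK // pnatr_eq0.
rewrite mulmx_suml mulmx_sumr -sumrB.
under eq_bigr => p _ do rewrite mulmx_suml mulmx_sumr -sumrB.
under eq_bigr => p _ do under eq_bigr => q _ do
  rewrite -scalemxAl -scalemxAr -scalerBr majorana_pair_comm_mode scalerBr !scalerA.
under eq_bigr => p _ do rewrite sumrB.
rewrite sumrB [X in _ - X]exchange_big /= -sumrB /mode scaler_sumr.
apply: eq_bigr => p _; rewrite -!scaler_suml -scalerBl scalerA; congr (_ *: _).
rewrite mxE -sumrB mulr_sumr; apply: eq_bigr => q _.
by rewrite (real_antisymC q p A_antisym); ring.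
Qed.

Lemma hatV_trmxC A : real_antisym A -> (hatV A) ^t* = hatV A.
Proof.
move=> A_antisym; have [A_real _] := A_antisym; rewrite /hatV trmxCZ trmxC_sum.
under eq_bigr => p _.
  rewrite trmxC_sum; under eq_bigr => q _.
    rewrite trmxCZ trmxC_mul !majorana_trmxC // (CrealP (A_real p q)).
    rewrite (real_antisymC p q A_antisym) scaleNr; over.
  over.
rewrite exchange_big /=; under eq_bigr => p _ do rewrite sumrN.
rewrite sumrN scalerN -scaleNr rmorphM /= conjCi fmorphV /= rmorph_nat.
by rewrite mulNr opprK.
Qed.

End QuadraticHamiltonians.

Section QuadraticGaps.
Variables (C : numClosedFieldType) (N : nat).
Implicit Types (A : 'M[C]_(2 * N)) (E : nat -> C).

Lemma hatV_normal A : real_antisym A -> hatV A \is normalmx.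
Proof. by move=> A_antisym; apply/normalmx_selfadj/hatV_trmxC. Qed.

Lemma hatV_first_gap_le A (v : 'cV[C]_(2 * N)) E (delta : C) :
  (0 < N)%N -> real_antisym A -> sorted_eigenvalues (hatV A) E ->
  v \is a realmx -> v != 0 -> 0 <= delta ->
  vnorm (A *m v) <= delta * vnorm v -> E 1%N - E 0%N <= delta.
Proof.
move=> N_gt0 A_antisym E_sorted v_real v_neq0 delta_ge0 Av_le.
have Av_real : A *m v \is a realmx by rewrite mxOverM ?real_antisym_realmx.
apply: (odd_operator_gap_le (B := mode v) (hatV_normal A_antisym) E_sorted)
  (parity_unitary C N) (parity_hatV A) (parity_mode v) _ _ => //.
- by rewrite -[X in (X < _)%N](expn0 2) ltn_exp2l.
- move=> x vx0; apply/eqP; rewrite -vnorm_eq0.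
  have /eqP : vnorm (mode v *m x) = 0 by rewrite vx0 vnorm0.
  by rewrite vnorm_mode_mul // mulf_eq0 (vnorm_eq0 v) (negPf v_neq0).
- move=> x; rewrite hatV_comm_mode // modeZ -scalemxAl vnormZ normCi mul1r.
  by rewrite !vnorm_mode_mul // mulrA ler_wpM2r ?vnorm_ge0.
Qed.

Lemma hatV_gap_ge k w A (X : 'M[C]_(2 * N, k)) E (mu e : C) :
  real_antisym A -> sorted_eigenvalues (hatV A) E -> row_full X ->
  mu \is Num.real -> 0 <= e ->
  (forall y : 'cV_k,
     vnorm ('i *: A *m (X *m y) + mu *: (X *m y)) <= e * vnorm (X *m y)) ->
  (w < 2 ^ N)%N -> (2 ^ N < 2 ^ k * w.+1)%N -> mu - e <= E w - E 0%N.
Proof.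
move=> A_antisym E_sorted X_full mu_real e_ge0 X_near lt_w lt_dim.
have [|Y [lam [Y_on Y_eig lam_near]]] :=
    orthonormal_eigenvectors_near (mu := - mu)
      (normalmx_imaginary_antisym A_antisym) X_full e_ge0.
  by move=> y; rewrite scaleNr opprK.
apply: (lowering_operators_gap_ge (b := fun i => mode (col i Y))
  (b' := fun j => 2^-1 *: mode (map_mx Num.conj (col j Y)))
  (lam := fun i => lam 0 i)
  (hatV_normal A_antisym) E_sorted) mu_real e_ge0 _ lt_w lt_dim.
- move=> i j; rewrite -scalemxAr -scalemxAl -scalerDr mode_anticomm.
  rewrite scale_scalar_mx mulrA mulVf ?pnatr_eq0 // mul1r; congr (_%:M).
  have /matrixP/(_ j i) := Y_on; rewrite !mxE eq_sym => <-.
  by apply: eq_bigr => p _; rewrite !mxE mulrC.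
- move=> i; rewrite hatV_comm_mode // scalemxAl (diagonalized_col i Y_eig).
  exact: modeZ.
- by move=> i; have := lam_near i; rewrite opprK.
Qed.

End QuadraticGaps.

(** * The chain and its modes *)

Section Entries.
Variable C : numClosedFieldType.

Definition entry n (x : 'cV[C]_n) (k : nat) : C :=
  if insub k is Some i then x i 0 else 0.

Lemma entryE n (x : 'cV[C]_n) (i : 'I_n) : entry x i = x i 0.
Proof. by rewrite /entry valK. Qed.

Lemma entry_out n (x : 'cV[C]_n) k : (n <= k)%N -> entry x k = 0.
Proof. by move=> le_nk; rewrite /entry insubN // -leqNgt. Qed.

Lemma sum_pick n (F : nat -> C) k :
  \sum_(i < n) (k == i :> nat)%:R * F i = if (k < n)%N then F k else 0.
Proof.
case: ltnP => [lt_kn|le_nk].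
  rewrite (bigD1 (Ordinal lt_kn)) //= eqxx mul1r big1 ?addr0 // => i.
  by rewrite -val_eqE /= eq_sym => /negPf->; rewrite mul0r.
by rewrite big1 // => i _; rewrite gtn_eqF ?mul0r // (leq_trans _ le_nk).
Qed.

Lemma sum_entry n (x : 'cV[C]_n) k :
  \sum_(i < n) (k == i :> nat)%:R * x i 0 = entry x k.
Proof.
under eq_bigr => i _ do rewrite -entryE.
by rewrite sum_pick; case: ltnP => // /entry_out->.
Qed.

Lemma entry_ord n (x : 'cV[C]_n) k (lt_kn : (k < n)%N) :
  entry x k = x (Ordinal lt_kn) 0.
Proof. exact: (entryE x (Ordinal lt_kn)). Qed.

End Entries.

Section Chain.
Variables (C : numClosedFieldType) (N : nat).
Implicit Types (x : 'cV[C]_(2 * N)) (p : 'I_(2 * N)).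

Definition skew_unit (a b : nat) : 'M[C]_(2 * N) :=
  \matrix_(p, q) (((p == a :> nat) && (q == b :> nat))%:R
                  - ((p == b :> nat) && (q == a :> nat))%:R).

Definition chain : 'M[C]_(2 * N) :=
  \sum_(j < N.-1) skew_unit (2 * j + 1) (2 * j + 2).

Lemma hatV_skew_unit (a b : nat) :
  (a < 2 * N)%N -> (b < 2 * N)%N -> a != b ->
  hatV (skew_unit a b) = ('i / 2) *: (majorana C N a *m majorana C N b).
Proof.
move=> lt_a lt_b neq_ab; pose p := Ordinal lt_a; pose q := Ordinal lt_b.
have -> : skew_unit a b = delta_mx p q - delta_mx q p.
  by apply/matrixP => s t; rewrite !mxE.
rewrite linearB /= !hatV_delta -scalerBr.
have /eqP := majorana_anticomm C lt_b lt_a.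
rewrite (eq_sym b) (negPf neq_ab) mulr0 raddf0 addr_eq0 => /eqP->.
rewrite opprK -mulr2n -scaler_nat scalerA; congr (_ *: _); by field.
Qed.

Lemma H0_hatV : H0 C N = hatV chain.
Proof.
rewrite /H0 [RHS]linear_sum scaler_sumr; apply: eq_bigr => j _.
by have lt_j := ltn_ord j; rewrite /= hatV_skew_unit //; lia.
Qed.

Lemma Ham_hatV (V : 'M[C]_(2 * N)) : Ham V = hatV (chain + V).
Proof. by rewrite /Ham H0_hatV linearD. Qed.

Lemma chain_real_antisym : real_antisym chain.
Proof.
split=> [p q|].
  by rewrite summxE rpred_sum // => j _; rewrite mxE rpredB ?realn.
rewrite linear_sum -sumrN; apply: eq_bigr => j _; apply/matrixP => p q.
by rewrite !mxE opprB [in X in _ - X]andbC [in X in X - _]andbC.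
Qed.

Lemma chain_range : has_range chain 1.
Proof.
move=> p q far_pq; rewrite summxE big1 // => j _; rewrite mxE.
have -> : (p == 2 * j + 1 :> nat)%N && (q == 2 * j + 2 :> nat)%N = false by lia.
have -> : (p == 2 * j + 2 :> nat)%N && (q == 2 * j + 1 :> nat)%N = false by lia.
exact: subrr.
Qed.

Lemma skew_unit_mulE (a b : nat) x p :
  (skew_unit a b *m x) p 0 =
  (p == a :> nat)%:R * entry x b - (p == b :> nat)%:R * entry x a.
Proof.
rewrite mxE -!sum_entry !mulr_sumr -sumrB; apply: eq_bigr => q _.
by rewrite mxE mulrBl !mulrA -!natrM !mulnb (eq_sym a) (eq_sym b).
Qed.

Lemma chain_mulE x p : (chain *m x) p 0 =
  if odd p then entry x p.+1 else if p == 0%N :> nat then 0 else - entry x p.-1.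
Proof.
have lt_p := ltn_ord p; rewrite mulmx_suml summxE.
have is_left j : (p == 2 * j + 1 :> nat)%N = odd p && (p./2 == j) by lia.
have is_right j :
    (p == 2 * j + 2 :> nat)%N = [&& ~~ odd p, (0 < p)%N & p./2.-1 == j] by lia.
under eq_bigr => j _ do rewrite skew_unit_mulE is_left is_right.
rewrite sumrB; case odd_p: (odd p) => /=.
  rewrite [X in _ - X]big1 ?subr0 => [|j _]; last exact: mul0r.
  rewrite (sum_pick _ (fun j => entry x (2 * j + 2))).
  have -> : (2 * p./2 + 2 = p.+1)%N by lia.
  by case: ltnP => // le_p; rewrite entry_out //; lia.
rewrite big1 ?sub0r => [|j _]; last exact: mul0r.
case: posnP => [->|p_gt0] /=.
  by rewrite big1 ?oppr0 // => j _; rewrite mul0r.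
rewrite (sum_pick _ (fun j => entry x (2 * j + 1))).
have -> : (2 * p./2.-1 + 1 = p.-1)%N by lia.
by have -> : (p./2.-1 < N.-1)%N by lia.
Qed.

Lemma chain_sqrE x p : (chain *m (chain *m x)) p 0 =
  if (0 < p < (2 * N).-1)%N then - x p 0 else 0.
Proof.
have lt_p := ltn_ord p; rewrite chain_mulE; case odd_p: (odd p).
  have [lt_p1|le_p1] := ltnP p.+1 (2 * N).
    rewrite entry_ord chain_mulE /= odd_p /= entryE.
    by have -> : (0 < p < (2 * N).-1)%N by lia.
  by rewrite entry_out //; have -> : (0 < p < (2 * N).-1)%N = false by lia.
case: eqP => [->//|p_neq0].
have lt_pred : (p.-1 < 2 * N)%N by lia.
rewrite entry_ord chain_mulE /=; have -> : odd p.-1 by lia.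
have -> : (0 < p < (2 * N).-1)%N by lia.
by rewrite prednK ?entryE //; lia.
Qed.

Lemma chain_opnorm : opnorm_le chain 1.
Proof.
move=> x; rewrite vnorm_le_sqr // expr1n mul1r sqr_vnorm trmxC_mul.
rewrite (trmxC_real_antisym chain_real_antisym).
rewrite mulmxN mulNmx -mulmxA mxE [X in - X]mxE -sumrN sqr_vnormE.
apply: ler_sum => p _; rewrite trmxCE chain_sqrE.
by case: ifP => _; rewrite ?mulrN ?opprK -?normCKC // mulr0 oppr0 exprn_ge0.
Qed.

Definition lowering_modes : 'M[C]_(2 * N, N.-1) :=
  \matrix_(p, j) (if odd p then - 'i * (p./2 == j :> nat)%:R
                  else ((p != 0%N :> nat) && (p./2.-1 == j :> nat))%:R).

Lemma lowering_modesE (y : 'cV[C]_N.-1) k :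
  entry (lowering_modes *m y) k =
  if odd k then - 'i * entry y k./2
  else if k == 0%N then 0 else entry y k./2.-1.
Proof.
have [lt_k|le_k] := ltnP k (2 * N); last first.
  rewrite entry_out //; case: ifP => _; last case: eqP => // k0.
    by rewrite entry_out ?mulr0 //; lia.
  by rewrite entry_out //; lia.
rewrite entry_ord mxE; case: ifP => odd_k.
  rewrite -sum_entry mulr_sumr; apply: eq_bigr => j _.
  by rewrite mxE /= odd_k mulrA.
case: eqP => [k0|/eqP k_neq0].
  by rewrite big1 // => j _; rewrite mxE /= odd_k k0 mul0r.
by rewrite -sum_entry; apply: eq_bigr => j _; rewrite mxE /= odd_k k_neq0.
Qed.

Lemma chain_lowering_modes (y : 'cV[C]_N.-1) :
  'i *: (chain *m (lowering_modes *m y)) = - (lowering_modes *m y).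
Proof.
apply/colP => p; rewrite [LHS]mxE [RHS]mxE chain_mulE -entryE !lowering_modesE.
case odd_p: (odd p).
  by rewrite /= odd_p /= uphalf_half odd_p add1n /= mulNr opprK.
case: eqP => p0; first by rewrite mulr0 oppr0.
have -> : odd p.-1 by lia.
have -> : (p.-1./2 = p./2.-1)%N by lia.
by rewrite mulNr opprK mulrA -expr2 sqrCi mulN1r.
Qed.

Lemma lowering_modes_full : row_full lowering_modes.
Proof.
apply: inj_row_full => y Xy0; apply/colP => j; rewrite -entryE [RHS]mxE.
have := lowering_modesE y j.*2.+2; rewrite Xy0 /= odd_double /= doubleK => <-.
by rewrite /entry; case: insubP => // i _ _; rewrite mxE.
Qed.

End Chain.

Section ZeroMode.
Variables (C : numClosedFieldType) (N : nat) (V : 'M[C]_(2 * N)) (r : nat).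
Hypotheses (V_antisym : real_antisym V) (V_range : has_range V r).
Local Notation A0 := (chain C N).
Local Notation walk := (alternating_prod A0 V).
Implicit Types p q : 'I_(2 * N).

Definition left_edge : 'cV[C]_(2 * N) := \col_p (p == 0%N :> nat)%:R.

Definition zero_mode (m : nat) : 'cV[C]_(2 * N) :=
  left_edge + \sum_(k < m) A0 *m (walk k *m left_edge).

Lemma mul_left_edge (M : 'M[C]_(2 * N)) p q : q = 0%N :> nat ->
  (M *m left_edge) p 0 = M p q.
Proof.
move=> q0; rewrite mxE (bigD1 q) //= mxE q0 eqxx mulr1 big1 ?addr0 // => t.
by rewrite -val_eqE /= q0 mxE => /negPf->; rewrite mulr0.
Qed.

Lemma chain_left_edge : A0 *m left_edge = 0.
Proof.
apply/colP => p.
pose p0 : 'I_(2 * N) := Ordinal (leq_ltn_trans (leq0n p) (ltn_ord p)).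
rewrite (@mul_left_edge _ p p0) // summxE mxE big1 // => j _.
by rewrite mxE addn1 addn2 !andbF subrr.
Qed.

(* [chain] squares to [-1] away from the two ends of the chain.  The vector
   [walk m *m left_edge] vanishes at the left end by antisymmetry, and at the
   right end as long as the range of [walk m] does not reach that far. *)
Lemma chain_sqr_walk m : (m.+1 * r.+1 < 2 * N)%N ->
  A0 *m (A0 *m (walk m *m left_edge)) = - (walk m *m left_edge).
Proof.
move=> lt_m; apply/colP => p; rewrite chain_sqrE [RHS]mxE.
case: ifP => // /negbT end_p.
have walk_antisym :=
  alternating_prod_real_antisym m (chain_real_antisym C N) V_antisym.
have walk_range := alternating_prod_range (m := m) (@chain_range C N) V_range.
have [p_eq0|p_gt0] := posnP p.
  by rewrite (mul_left_edge _ _ p_eq0) (real_antisym_diag _ walk_antisym) oppr0.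
pose p0 : 'I_(2 * N) := Ordinal (ltn_trans p_gt0 (ltn_ord p)).
by rewrite (@mul_left_edge _ p p0) // walk_range ?oppr0 //= addn1; lia.
Qed.

Lemma zero_mode_residual m : (m * r.+1 < 2 * N)%N ->
  (A0 + V) *m zero_mode m = walk m *m left_edge.
Proof.
elim: m => [|m IH] lt_m.
  by rewrite /zero_mode big_ord0 addr0 mulmxDl chain_left_edge add0r.
have -> : zero_mode m.+1 = zero_mode m + A0 *m (walk m *m left_edge).
  by rewrite /zero_mode big_ord_recr addrA.
have lt_m' : (m * r.+1 < 2 * N)%N.
  by apply: leq_ltn_trans lt_m; rewrite leq_mul2r leqnSn orbT.
by rewrite mulmxDr IH // mulmxDl chain_sqr_walk // addNKr !mulmxA.
Qed.

Lemma zero_mode_real m : zero_mode m \is a realmx.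
Proof.
have edge_real : left_edge \is a realmx.
  by apply/mxOverP => p q; rewrite mxE realn.
have walk_real k := real_antisym_realmx
  (alternating_prod_real_antisym k (chain_real_antisym C N) V_antisym).
have A0_real := real_antisym_realmx (chain_real_antisym C N).
have term_real k : A0 *m (walk k *m left_edge) \is a realmx by rewrite !mxOverM.
apply: realmxD => //; apply/mxOverP => p q; rewrite summxE rpred_sum // => k _.
exact: (mxOverP (term_real k)).
Qed.

Lemma vnorm_left_edge : (0 < N)%N -> vnorm left_edge = 1.
Proof.
move=> N_gt0; have lt_0 : (0 < 2 * N)%N by rewrite muln_gt0.
rewrite /vnorm (bigD1 (Ordinal lt_0)) //= mxE normr1 expr1n.
rewrite big1 ?addr0 ?sqrtC1 // => p.
by rewrite -val_eqE mxE /= => /negPf->; rewrite normr0 expr0n.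
Qed.

Lemma vnorm_zero_mode_ge1 m : (0 < N)%N -> 1 <= vnorm (zero_mode m).
Proof.
move=> N_gt0; have lt_0 : (0 < 2 * N)%N by rewrite muln_gt0.
apply: le_trans (normr_le_vnorm (zero_mode m) (Ordinal lt_0)).
rewrite mxE summxE big1 => [|k _]; last by rewrite chain_mulE.
by rewrite mxE addr0 normr1.
Qed.

Lemma zero_mode_small (eps : C) m :
  opnorm_le V eps -> 0 <= eps -> (0 < N)%N -> (m * r.+1 < 2 * N)%N ->
  vnorm ((A0 + V) *m zero_mode m) <= eps ^+ m.+1 * vnorm (zero_mode m).
Proof.
move=> V_le eps_ge0 N_gt0 lt_m; rewrite zero_mode_residual //.
have := alternating_prod_opnorm m ler01 eps_ge0 (@chain_opnorm C N) V_le left_edge.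
rewrite mulr1 -exprSr => /le_trans->//; rewrite ler_wpM2l ?exprn_ge0 //.
by rewrite vnorm_left_edge // vnorm_zero_mode_ge1.
Qed.

End ZeroMode.

Lemma exprn_le_rate_root (C : numClosedFieldType) (N r m : nat) (eps : C) :
  (0 < r)%N -> 0 <= eps -> eps < 1 -> (2 * N <= m * r.+1)%N ->
  eps ^+ m <= (2 * r).-root ((2 * eps / (1 + eps)) ^+ N).
Proof.
move=> r_gt0 eps_ge0 eps_lt1 le_Nm.
have r2_gt0 : (0 < 2 * r)%N by lia.
rewrite -(exprCK r2_gt0 (exprn_ge0 m eps_ge0)) ler_rootCl ?nnegrE ?exprn_ge0 //.
have eps1_gt0 : 0 < 1 + eps by rewrite ltr_wpDr.
have le_eps : eps <= 2 * eps / (1 + eps).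
  by rewrite ler_pdivlMr // mulrC ler_wpM2r // -[2]/(1 + 1) lerD2l ltW.
apply: (@le_trans _ _ (eps ^+ N)).
  by rewrite -exprM ler_wiXn2l ?(ltW eps_lt1) //; nia.
by rewrite lerXn2r // nnegrE ?divr_ge0 ?mulr_ge0 ?(ltW eps1_gt0).
Qed.

Section Gaps.
Variables (C : numClosedFieldType) (N r : nat) (eps : C) (V : 'M[C]_(2 * N)).
Hypotheses (N_ge2 : (2 <= N)%N) (eps_ge0 : 0 <= eps).
Hypotheses (V_antisym : real_antisym V) (V_le : opnorm_le V eps).
Variable E : nat -> C.
Hypothesis E_sorted : sorted_eigenvalues (Ham V) E.

Let coupling_antisym : real_antisym (chain C N + V).
Proof. exact: real_antisymD (chain_real_antisym C N) V_antisym. Qed.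

Let hatV_sorted : sorted_eigenvalues (hatV (chain C N + V)) E.
Proof. by rewrite -Ham_hatV. Qed.

Lemma first_gap_le m : has_range V r -> (m * r.+1 < 2 * N)%N ->
  E 1%N - E 0%N <= eps ^+ m.+1.
Proof.
move=> V_range lt_m; have N_gt0 := ltnW N_ge2.
apply: (hatV_first_gap_le N_gt0 coupling_antisym hatV_sorted
          (zero_mode_real V_antisym m)).
- by rewrite -vnorm_eq0 gt_eqF // (lt_le_trans ltr01) // vnorm_zero_mode_ge1.
- exact: exprn_ge0.
- exact: (zero_mode_small V_antisym V_range).
Qed.

Lemma second_level_gap_ge : 1 - eps <= E 2%N - E 0%N.
Proof.
apply: (hatV_gap_ge coupling_antisym hatV_sorted (lowering_modes_full C N)) => //.
- move=> y; set x := lowering_modes C N *m y.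
  rewrite -scalemxAl mulmxDl scalerDr chain_lowering_modes scale1r addrAC addNr.
  by rewrite add0r vnormZ normCi mul1r.
- by rewrite (@leq_trans (2 ^ 2)) // leq_exp2l.
- by rewrite -{1}(prednK (ltnW N_ge2)) expnS mulnC ltn_pmul2l ?expn_gt0.
Qed.

End Gaps.

Theorem mainTheorem1 (C : numClosedFieldType) (HC : real_complete C)
    (r : nat) (eps : C) :
  (1 <= r)%N -> 0 <= eps -> eps < 1 ->
  exists N0 : nat, forall N : nat, (N0 <= N)%N -> (2 <= N)%N ->
    forall V : 'M[C]_(2 * N),
      real_antisym V -> opnorm_le V eps -> has_range V r ->
      forall E : nat -> C, sorted_eigenvalues (Ham V) E ->
        E 1%N - E 0%N <= (2 * r).-root ((2 * eps / (1 + eps)) ^+ N) /\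
        E 2%N - E 1%N >= 1 - eps - (2 * r).-root ((2 * eps / (1 + eps)) ^+ N).
Proof.
move=> r_gt0 eps_ge0 eps_lt1; exists 0%N => N _ N_ge2.
move=> V V_antisym V_le V_range E E_sorted.
set rate := _.-root _; pose m := ((2 * N).-1 %/ r.+1)%N.
have lt_m : (m * r.+1 < 2 * N)%N.
  by have := leq_divM (2 * N).-1 r.+1; rewrite -/m; lia.
have le_m : (2 * N <= m.+1 * r.+1)%N.
  by have := @ltn_ceil (2 * N).-1 r.+1 isT; rewrite -/m; lia.
have gap1 : E 1%N - E 0%N <= rate.
  apply: le_trans (exprn_le_rate_root r_gt0 eps_ge0 eps_lt1 le_m).
  exact: first_gap_le V_range lt_m.
split=> //; have gap2 := second_level_gap_ge N_ge2 eps_ge0 V_antisym V_le E_sorted.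
have -> : E 2%N - E 1%N = (E 2%N - E 0%N) - (E 1%N - E 0%N) by ring.
exact: lerB.
Qed.
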